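(* Let $p$ be a prime and $t$ an integer with $t\geq 2$. Then the group $\Delta(p^{-2},2t)$ is neither pseudomodular nor arithmetic. In particular, infinitely many groups $\Delta(u^2,2t)$ are neither pseudomodular nor arithmetic.
   Context: For rational numbers $u^2$ and $t$ with $0<u^2<t-1$, $\Delta(u^2,2t)\subset\operatorname{PSL}_2(\mathbb{R})$ is the group generated by \[ g_1 = \frac{1}{\sqrt{-1+t-u^2}}\begin{pmatrix} t-1 & u^2 \\ 1 & 1 \end{pmatrix},\qquad g_2 = \frac{1}{u\sqrt{-1+t-u^2}}\begin{pmatrix} u^2 & u^2 \\ 1 & t-u^2 \end{pmatrix}, \] where $u=\sqrt{u^2}>0$; it is a finite coarea Fuchsian group with cusps in $\mathbb{P}^1(\mathbb{Q})$. A cusp of a Fuchsian group $G$ is a point of $\mathbb{P}^1(\mathbb{R})$ that is the unique fixed point of some element of $G$. A finite coarea Fuchsian group is arithmetic if it is commensurable with $\operatorname{PSL}_2(\mathbb{Z})$, and pseudomodular if it is nonarithmetic and its cusp set is exactly $\mathbb{P}^1(\mathbb{Q})$. *)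

(* Defs.v *)
From HB Require Import structures.
From mathcomp Require Import all_boot all_order all_algebra.
From mathcomp Require Import fingroup generic_quotient.
From mathcomp Require Import ring.
From mathcomp Require Import all_classical reals.

Set Implicit Arguments.
Unset Strict Implicit.
Unset Printing Implicit Defensive.

Import Order.TTheory GRing.Theory Num.Theory.

Local Open Scope classical_set_scope.
Local Open Scope ring_scope.
Local Open Scope quotient_scope.

Section Groups.
Variable T : groupType.
Implicit Types G H S : set T.

Definition is_subgroup H : Prop :=
  [/\ H 1%g, (forall x y, H x -> H y -> H (x * y)%g) &
      (forall x, H x -> H x^-1%g)].

Definition generated S : set T := smallest is_subgroup S.

Definition left_cosets H G : set (set T) :=
  [set [set (x * h)%g | h in H] | x in G].

Definition finite_index H G : Prop := finite_set (left_cosets H G).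

Definition commensurable G H : Prop :=
  finite_index (G `&` H) G /\ finite_index (G `&` H) H.

End Groups.

Section SL2.
Variable R : comNzRingType.

Record SL2 := MkSL2 { SL2_val :> 'M[R]_2; _ : \det SL2_val == 1 }.

HB.instance Definition _ := [isSub for SL2_val].
HB.instance Definition _ := [Choice of SL2 by <:].

Implicit Types A B C : SL2.

Lemma SL2_det A : \det (val A) = 1.
Proof. by apply/eqP; case: A. Qed.

Lemma SL2_one_subproof : \det (1%:M : 'M[R]_2) == 1.
Proof. by rewrite det1. Qed.

Lemma SL2_mul_subproof A B : \det (val A *m val B) == 1.
Proof. by rewrite det_mulmx !SL2_det mulr1. Qed.

Lemma SL2_inv_subproof A : \det (\adj (val A)) == 1.
Proof.
have := congr1 determinant (mul_mx_adj (val A)).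
by rewrite det_mulmx det_scalar SL2_det mul1r expr1n => ->.
Qed.

Lemma SL2_opp_subproof A : \det (- val A) == 1.
Proof. by rewrite -scaleN1r detZ SL2_det sqrrN expr1n mulr1. Qed.

Definition SL2_one : SL2 := MkSL2 SL2_one_subproof.
Definition SL2_mul A B : SL2 := MkSL2 (SL2_mul_subproof A B).
Definition SL2_inv A : SL2 := MkSL2 (SL2_inv_subproof A).
Definition SL2_opp A : SL2 := MkSL2 (SL2_opp_subproof A).

Lemma SL2_mulA : associative SL2_mul.
Proof. by move=> A B C; apply/val_inj/mulmxA. Qed.

Lemma SL2_mul1x : left_id SL2_one SL2_mul.
Proof. by move=> A; apply/val_inj/mul1mx. Qed.

Lemma SL2_mulx1 : right_id SL2_one SL2_mul.
Proof. by move=> A; apply/val_inj/mulmx1. Qed.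

Lemma SL2_mulVx : left_inverse SL2_one SL2_inv SL2_mul.
Proof. by move=> A; apply/val_inj; rewrite /= mul_adj_mx SL2_det. Qed.

Lemma SL2_mulxV : right_inverse SL2_one SL2_inv SL2_mul.
Proof. by move=> A; apply/val_inj; rewrite /= mul_mx_adj SL2_det. Qed.

HB.instance Definition _ :=
  isGroup.Build SL2 SL2_mulA SL2_mul1x SL2_mulx1 SL2_mulVx SL2_mulxV.

Definition SL2_pm A B : bool := (A == B) || (A == SL2_opp B).

Lemma SL2_oppK : involutive SL2_opp.
Proof. by move=> A; apply/val_inj/opprK. Qed.

Lemma SL2_pm_refl : reflexive SL2_pm.
Proof. by move=> A; rewrite /SL2_pm eqxx. Qed.

Lemma SL2_pm_sym : symmetric SL2_pm.
Proof.
move=> A B; rewrite /SL2_pm eq_sym; congr (_ || _).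
by rewrite eq_sym (can2_eq SL2_oppK SL2_oppK).
Qed.

Lemma SL2_pm_trans : transitive SL2_pm.
Proof.
move=> B A C; rewrite /SL2_pm.
move=> /orP[]/eqP-> /orP[]/eqP->; rewrite ?SL2_oppK ?eqxx ?orbT //.
Qed.

Canonical SL2_pm_equiv :=
  EquivRel SL2_pm SL2_pm_refl SL2_pm_sym SL2_pm_trans.

Definition PSL2 := {eq_quot SL2_pm}.

HB.instance Definition _ := Choice.on PSL2.
HB.instance Definition _ := EqQuotient.on PSL2.

Definition PSL2_one : PSL2 := \pi_PSL2 SL2_one.
Definition PSL2_mul (x y : PSL2) : PSL2 := \pi_PSL2 (SL2_mul (repr x) (repr y)).
Definition PSL2_inv (x : PSL2) : PSL2 := \pi_PSL2 (SL2_inv (repr x)).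

Lemma PSL2_eqP A B :
  \pi_PSL2 A = \pi_PSL2 B <-> A = B \/ A = SL2_opp B.
Proof.
split=> [/eqP|h].
  by rewrite eqmodE => /orP[]/eqP; [left|right].
by apply/eqP; rewrite eqmodE; apply/orP; case: h => ->; [left|right].
Qed.

Lemma PSL2_repr_pi A : repr (\pi_PSL2 A) = A \/ repr (\pi_PSL2 A) = SL2_opp A.
Proof. by apply/PSL2_eqP; rewrite reprK. Qed.

Lemma PSL2_pi_opp A : \pi_PSL2 (SL2_opp A) = \pi_PSL2 A.
Proof. by apply/PSL2_eqP; right. Qed.

Lemma PSL2_pi_mul A B :
  \pi_PSL2 (SL2_mul A B) = PSL2_mul (\pi_PSL2 A) (\pi_PSL2 B).
Proof.
have oppl C D : SL2_mul (SL2_opp C) D = SL2_opp (SL2_mul C D).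
  by apply/val_inj/mulNmx.
have oppr C D : SL2_mul C (SL2_opp D) = SL2_opp (SL2_mul C D).
  by apply/val_inj/mulmxN.
rewrite /PSL2_mul.
by case: (PSL2_repr_pi A) => ->; case: (PSL2_repr_pi B) => ->;
  rewrite ?oppl ?oppr ?PSL2_pi_opp.
Qed.

Lemma PSL2_pi_inv A : \pi_PSL2 (SL2_inv A) = PSL2_inv (\pi_PSL2 A).
Proof.
rewrite /PSL2_inv; case: (PSL2_repr_pi A) => -> //.
rewrite -PSL2_pi_opp; congr (\pi _).
apply/val_inj/matrixP=> i j.
by rewrite !mxE /cofactor !det_mx11 !mxE mulrN.
Qed.

Lemma PSL2W (P : PSL2 -> Prop) : (forall A, P (\pi_PSL2 A)) -> forall x, P x.
Proof. by move=> h x; rewrite -[x]reprK; apply: h. Qed.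

Lemma PSL2_mulA : associative PSL2_mul.
Proof.
by elim/PSL2W=> A; elim/PSL2W=> B; elim/PSL2W=> C; rewrite -!PSL2_pi_mul SL2_mulA.
Qed.

Lemma PSL2_mul1x : left_id PSL2_one PSL2_mul.
Proof. by elim/PSL2W=> A; rewrite -PSL2_pi_mul SL2_mul1x. Qed.

Lemma PSL2_mulx1 : right_id PSL2_one PSL2_mul.
Proof. by elim/PSL2W=> A; rewrite -PSL2_pi_mul SL2_mulx1. Qed.

Lemma PSL2_mulVx : left_inverse PSL2_one PSL2_inv PSL2_mul.
Proof. by elim/PSL2W=> A; rewrite -PSL2_pi_inv -PSL2_pi_mul SL2_mulVx. Qed.

Lemma PSL2_mulxV : right_inverse PSL2_one PSL2_inv PSL2_mul.
Proof. by elim/PSL2W=> A; rewrite -PSL2_pi_inv -PSL2_pi_mul SL2_mulxV. Qed.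

HB.instance Definition _ :=
  isGroup.Build PSL2 PSL2_mulA PSL2_mul1x PSL2_mulx1 PSL2_mulVx PSL2_mulxV.

(* The class of [M] when [\det M = 1]; the identity otherwise. *)
Definition to_PSL2 (M : 'M[R]_2) : PSL2 := \pi_PSL2 (insubd SL2_one M).

End SL2.

Section Fuchsian.
Variable R : realType.

(* [Some x] is the point [x : 1] and [None] is the point at infinity [1 : 0]. *)
Definition P1 := option R.

Definition P1Q : set P1 :=
  [set z | z = None \/ exists q : rat, z = Some (ratr q)].

Definition mobius (M : 'M[R]_2) (z : P1) : P1 :=
  let a := M 0 0 in let b := M 0 1 in let c := M 1 0 in let d := M 1 1 in
  match z with
  | Some x => if c * x + d == 0 then None else Some ((a * x + b) / (c * x + d))
  | None => if c == 0 then None else Some (a / c)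
  end.

Definition PSL2_act (g : PSL2 R) (z : P1) : P1 := mobius (val (repr g)) z.

Lemma mobiusN (M : 'M[R]_2) z : mobius (- M) z = mobius M z.
Proof.
case: z => [x|]; rewrite /mobius !mxE.
  by rewrite mulNr -opprD oppr_eq0 mulNr -opprD invrN mulrNN.
by rewrite oppr_eq0 invrN mulrNN.
Qed.

Lemma PSL2_act_pi (A : SL2 R) z : PSL2_act (\pi_(PSL2 R) A) z = mobius (val A) z.
Proof.
by rewrite /PSL2_act; case: (PSL2_repr_pi A) => -> //; rewrite mobiusN.
Qed.

Definition cusp_set (G : set (PSL2 R)) : set P1 :=
  [set z | exists2 g, G g & forall w, PSL2_act g w = w <-> w = z].

Definition PSL2Z : set (PSL2 R) :=
  [set \pi_(PSL2 R) A | A in [set A : SL2 R | val A \is a mxOver Num.int]].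

(* [arithmetic] and [pseudomodular] are meant for finite coarea Fuchsian groups
   only; that property, which the groups [Delta] below have, is not recorded
   here, so that it cannot weaken a negated conclusion. *)
Definition arithmetic (G : set (PSL2 R)) : Prop := commensurable G PSL2Z.

Definition pseudomodular (G : set (PSL2 R)) : Prop :=
  ~ arithmetic G /\ cusp_set G = P1Q.

Definition mx22 (a b c d : R) : 'M[R]_2 :=
  \matrix_(i, j) if i == 0 then if j == 0 then a else b
                 else if j == 0 then c else d.

Definition Delta_g1 (u2 t : rat) : 'M[R]_2 :=
  let v : R := ratr u2 in let s : R := ratr t in
  (Num.sqrt (- 1 + s - v))^-1 *: mx22 (s - 1) v 1 1.

Definition Delta_g2 (u2 t : rat) : 'M[R]_2 :=
  let v : R := ratr u2 in let s : R := ratr t in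
  (Num.sqrt v * Num.sqrt (- 1 + s - v))^-1 *: mx22 v v 1 (s - v).

(* [Delta u2 t] is the group usually written Delta(u^2, 2t), where [u2] is u^2:
   the second argument is [t], not [2t]. *)
Definition Delta (u2 t : rat) : set (PSL2 R) :=
  generated [set to_PSL2 (Delta_g1 u2 t); to_PSL2 (Delta_g2 u2 t)].

Lemma det_mx22 a b c d : \det (mx22 a b c d) = a * d - b * c.
Proof.
rewrite (expand_det_row _ 0) !big_ord_recl big_ord0 /cofactor !det_mx11 !mxE /=.
by rewrite expr0 expr1; ring.
Qed.

Lemma Delta_pos (u2 t : rat) : u2 < t - 1 -> 0 < - 1 + ratr t - ratr u2 :> R.
Proof.
rewrite -(ltr_rat R) rmorphB rmorph1 -subr_gt0.
by rewrite [X in _ < X - _]addrC.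
Qed.

(* In the admissible range the default value in [to_PSL2] is never used. *)
Lemma det_Delta_g1 (u2 t : rat) : u2 < t - 1 -> \det (Delta_g1 u2 t) = 1.
Proof.
move=> /Delta_pos; rewrite /Delta_g1 detZ det_mx22 exprVn => h.
rewrite sqr_sqrtr ?ltW // !mulr1 (_ : _ - 1 - _ = - 1 + ratr t - ratr u2).
  by rewrite mulVf // gt_eqF.
by ring.
Qed.

Lemma det_Delta_g2 (u2 t : rat) :
  0 < u2 -> u2 < t - 1 -> \det (Delta_g2 u2 t) = 1.
Proof.
move=> u0 /Delta_pos; rewrite /Delta_g2 detZ det_mx22 exprVn => h.
have v0 : 0 < ratr u2 :> R by rewrite ltr0q.
rewrite exprMn !sqr_sqrtr ?ltW // mulr1.
rewrite (_ : _ * _ - _ = ratr u2 * (- 1 + ratr t - ratr u2)); last by ring.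
by rewrite mulVf // mulf_neq0 // gt_eqF.
Qed.

End Fuchsian.

Arguments Delta R u2 t : clear implicits.
Arguments Delta_g1 R u2 t : clear implicits.
Arguments Delta_g2 R u2 t : clear implicits.

(* Main.v *)
Require Import Defs.
From HB Require Import structures.
From mathcomp Require Import all_boot all_order all_algebra.
From mathcomp Require Import fingroup generic_quotient ring lra zify.
From mathcomp Require Import all_classical reals.

(* The rational point 1/p is not a cusp.

   Conjugating by x |-> p x turns the generators into the integral matrices
   [[(t-1)p, 1], [1, p]] and [[1, p], [p, t p^2 - 1]], both of determinant
   D = (t-1)p^2 - 1.  Modulo p they are monomial, so the points m/n with m and n
   prime to p are permuted by the group, and 1/p becomes such a point, namely 1.
   On the other hand the ideal quadrilateral with vertices oo, -p, 0, 1/p is a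
   fundamental domain: ping-pong on its four boundary arcs shows that the fixed
   point of a parabolic element given by a cyclically reduced word is a vertex,
   and no vertex has the form m/n above.  Hence the cusp set is not P^1(Q).
   Since every rational point is fixed by a parabolic element of PSL_2(Z), whose
   powers meet each subgroup of finite index, arithmeticity is excluded as well.

   For p = 2, equality of the groups with parameters t and t' forces
   D' m^2 = D^n, which fails along a sequence of t with pairwise coprime D. *)

Set Implicit Arguments.
Unset Strict Implicit.
Unset Printing Implicit Defensive.

Import Order.TTheory GRing.Theory Num.Theory.

Local Open Scope classical_set_scope.
Local Open Scope ring_scope.

(** * Linear action on the plane and parabolic matrices *)

Section PlaneAction.
Variable F : realFieldType.
Implicit Types (M N : 'M[F]_2) (z w e f : F * F).

Definition mxact M z : F * F :=
  (M 0 0 * z.1 + M 0 1 * z.2, M 1 0 * z.1 + M 1 1 * z.2).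

Definition cross w z : F := w.1 * z.2 - w.2 * z.1.

Lemma mulmx22E M N i j : (M *m N) i j = M i 0 * N 0 j + M i 1 * N 1 j.
Proof.
by rewrite mxE !big_ord_recl big_ord0 addr0 (_ : lift _ _ = 1) //; apply/val_inj.
Qed.

Lemma matrix22P M N : M 0 0 = N 0 0 -> M 0 1 = N 0 1 -> M 1 0 = N 1 0 ->
  M 1 1 = N 1 1 -> M = N.
Proof.
move=> h00 h01 h10 h11; apply/matrixP=> i j.
have ord2 (k : 'I_2) : k = 0 \/ k = 1.
  by case: k => [[|[|//]] ?]; [left|right]; apply/val_inj.
by case: (ord2 i) => ->; case: (ord2 j) => ->.
Qed.

Lemma mxactM M N z : mxact (M *m N) z = mxact M (mxact N z).
Proof. by rewrite /mxact !mulmx22E /=; congr (_, _); ring. Qed.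

(** The scalar [l] plus [k] times a nilpotent map with image in the line of [z]: up to scaling, a
    parabolic map fixing [z]. *)
Definition parab (l k : F) z w : F * F :=
  (l * w.1 + k * cross w z * z.1, l * w.2 + k * cross w z * z.2).

(* The product form [cross w e * cross w f] vanishes at [e] and [f]; the two
   inequalities at the images of [e] and [f] add up to [0 <= 2 k^2 q(z)]. *)
Lemma parab_fixed_in_cone (l k : F) z e f : k != 0 ->
  (forall w, 0 <= cross w e * cross w f ->
     0 <= cross (parab l k z w) e * cross (parab l k z w) f) ->
  0 <= cross z e * cross z f.
Proof.
move=> k0 h; rewrite leNgt; apply/negP => q_lt0.
have [ze0 zf0] : cross z e != 0 /\ cross z f != 0.
  by apply/andP; rewrite -negb_or -mulf_eq0 lt_eqF.
have q_e x : cross x x = 0 by rewrite /cross; ring.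
have := h e; rewrite q_e mul0r => /(_ (lexx _)).
have := h f; rewrite q_e mulr0 => /(_ (lexx _)).
rewrite (_ : _ * _ = cross z f ^+ 2 *
   (k * l * cross e f + k ^+ 2 * (cross z e * cross z f))); last first.
  by rewrite /parab /cross /=; ring.
rewrite pmulr_rge0 ?exprn_even_gt0 // => hf.
rewrite (_ : _ * _ = cross z e ^+ 2 *
   (- (k * l * cross e f) + k ^+ 2 * (cross z e * cross z f))); last first.
  by rewrite /parab /cross /=; ring.
rewrite pmulr_rge0 ?exprn_even_gt0 // => he.
have : 0 < k ^+ 2 by rewrite exprn_even_gt0.
by move=> /pmulr_rlt0 kq; have := kq (cross z e * cross z f); rewrite q_lt0; lra.
Qed.

Definition parabolic_at M z :=
  exists l k : F, [/\ l != 0, k != 0 & forall w, mxact M w = parab l k z w].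

Lemma mxact_scalar (a : F) z : mxact a%:M z = (a * z.1, a * z.2).
Proof. by rewrite /mxact !mxE /=; congr pair; ring. Qed.

Lemma parabolicZ (a : F) M z : a != 0 -> parabolic_at (a *: M) z ->
  parabolic_at M z.
Proof.
move=> a0 [l [k [l0 k0 h]]]; exists (l / a), (k / a).
split; rewrite ?mulf_neq0 ?invr_eq0 // => w.
have := h w; rewrite /mxact /parab !mxE /= => -[e1 e2].
congr pair; apply: (mulfI a0).
  by rewrite mulrDr !mulrA e1; field.
by rewrite mulrDr !mulrA e2; field.
Qed.

End PlaneAction.

Lemma mx22_over_int (R : realType) (a b c d : R) :
  a \is a Num.int -> b \is a Num.int -> c \is a Num.int -> d \is a Num.int ->
  mx22 a b c d \is a mxOver Num.int.
Proof. by move=> *; apply/mxOverP => i j; rewrite mxE; case: ifP; case: ifP. Qed.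

(* A letter [(b, i)] is the generator [b] (false: g1, true: g2), inverted if [i]. *)
Notation letter := (bool * bool)%type.
Definition inv_letter (s : letter) : letter := (s.1, ~~ s.2).

Lemma inv_letterK : involutive inv_letter.
Proof. by case=> a b; rewrite /inv_letter /= negbK. Qed.

Lemma inv_letter_neq s : inv_letter s != s.
Proof. by case: s => [] [] []. Qed.

(** * Ping-pong for words in the rescaled generators *)

Section Words.
Variables (R : realType) (p : nat) (t : int).
Hypotheses (p_prime : prime p) (t_ge2 : 2 <= t).
Local Notation P := (p%:R : R).
Local Notation T := (t%:~R : R).
Definition letter_det : R := (T - 1) * P ^+ 2 - 1.
Local Notation D := letter_det.
Implicit Types (z w : R * R) (s : letter) (u : seq letter).

Let P_ge2 : 2 <= P.
Proof. by rewrite ler_nat prime_gt1. Qed.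

Let T_ge2 : 2 <= T.
Proof. by rewrite (ler_int _ 2). Qed.

Lemma letter_det_gt0 : 0 < D.
Proof.
rewrite /letter_det subr_gt0; apply: lt_le_trans (_ : 1 * 2 ^+ 2 <= _); first by lra.
by apply: ler_pM; rewrite ?lerXn2r ?nnegrE //; have := P_ge2; have := T_ge2; lra.
Qed.
#[local] Hint Resolve letter_det_gt0 : core.

Definition letter_mx s : 'M[R]_2 :=
  match s with
  | (false, false) => mx22 ((T - 1) * P) 1 1 P
  | (false, true) => mx22 P (- 1) (- 1) ((T - 1) * P)
  | (true, false) => mx22 1 P P (T * P ^+ 2 - 1)
  | (true, true) => mx22 (T * P ^+ 2 - 1) (- P) (- P) 1
  end.

(* [0 <= cone s z] says that [z] lies in the closed boundary arc into which
   [letter_mx s] maps the complement of the arc of [inv_letter s]. *)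
Definition cone s z : R :=
  match s with
  | (false, false) => z.2 * (P * z.1 - z.2)
  | (false, true) => - (z.1 * (z.1 + P * z.2))
  | (true, false) => - (z.1 * (P * z.1 - z.2))
  | (true, true) => - (z.2 * (z.1 + P * z.2))
  end.

(** Ping-pong as an identity of quadratic forms: as [D] is positive, the preimage of the arc of [s]
    is exactly the closed complement of the arc of [inv_letter s]. *)
Lemma cone_letter s z :
  cone s (mxact (letter_mx s) z) = - (D * cone (inv_letter s) z).
Proof.
by case: s => [] [] []; rewrite /mxact /= !mxE /= /letter_det; ring.
Qed.

Lemma cone_disjoint s s' z : s != s' -> 0 <= cone s z -> cone s' z <= 0.
Proof.
move: z => [x y]; have P0 := P_ge2.
(* The squares of the four linear forms that vanish at the vertices, as hints for [nra]. *)
have hx : 0 <= x ^+ 2 by exact: sqr_ge0.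
have hy : 0 <= y ^+ 2 by exact: sqr_ge0.
have h1 : 0 <= (P * x - y) ^+ 2 by exact: sqr_ge0.
have h2 : 0 <= (x + P * y) ^+ 2 by exact: sqr_ge0.
by case: s s' => [] [] [] [[] []] //= _ h; nra.
Qed.

(** Distinct arcs meet only at endpoints; the product is that of the linear forms vanishing at the
    four vertices. *)
Lemma cone_vertex s s' z : s != s' -> 0 <= cone s z -> 0 <= cone s' z ->
  z.1 * z.2 * (P * z.1 - z.2) * (z.1 + P * z.2) = 0.
Proof.
move=> ss' h h'.
have c0 : cone s z = 0.
  by apply/eqP; rewrite eq_le h andbT; apply: cone_disjoint h'; rewrite eq_sym.
move: c0; rewrite /cone; case: s {ss' h h'} => [] [] [] /= /eqP;
  by rewrite ?oppr_eq0 mulf_eq0 => /orP[]/eqP h; rewrite ?h; ring: h.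
Qed.

Lemma cone_cross s : exists e f : R * R,
  forall z, cone s z = cross z e * cross z f.
Proof.
case: s => [] [] [].
- by exists (1, 0), (-P, 1) => z; rewrite /cross /=; ring.
- by exists (0, 1), (-1, -P) => z; rewrite /cross /=; ring.
- by exists (0, 1), (P, -1) => z; rewrite /cross /=; ring.
- by exists (1, 0), (-1, -P) => z; rewrite /cross /=; ring.
Qed.

Lemma letter_mulV s : letter_mx s *m letter_mx (inv_letter s) = D%:M.
Proof.
apply: matrix22P; rewrite ?mulmx22E;
by case: s => [] [] []; rewrite !mxE /= /letter_det; ring.
Qed.

Lemma det_letter s : \det (letter_mx s) = D.
Proof. by case: s => [] [] []; rewrite det_mx22 /letter_det; ring. Qed.

Definition word_mx u : 'M[R]_2 := foldr (fun s M => letter_mx s *m M) 1%:M u.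

Lemma word_mx_cat u1 u2 : word_mx (u1 ++ u2) = word_mx u1 *m word_mx u2.
Proof. by elim: u1 => [|s u1 IH] /=; rewrite ?mul1mx // IH mulmxA. Qed.

Lemma det_word_mx u : \det (word_mx u) = D ^+ size u.
Proof.
elim: u => [|s u IH] /=; first by rewrite det1 expr0.
by rewrite det_mulmx det_letter IH exprS.
Qed.

Lemma word_mx_inv u : exists u', word_mx u' *m word_mx u = (D ^+ size u)%:M.
Proof.
elim: u => [|s u [u' IH]]; first by exists [::]; rewrite /= mulmx1.
exists (u' ++ [:: inv_letter s]).
rewrite word_mx_cat /= mulmx1 mulmxA -(mulmxA (word_mx u')).
have := letter_mulV (inv_letter s); rewrite inv_letterK => ->.
by rewrite mul_mx_scalar -scalemxAl IH scale_scalar_mx -exprS.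
Qed.

Lemma word_mx_int u : word_mx u \is a mxOver Num.int.
Proof.
elim: u => [|s u IH] /=; first by rewrite mxOver_scalar ?rpred0 ?rpred1.
rewrite mxOverM //; case: s => [] [] []; apply: mx22_over_int;
  by rewrite ?rpredB ?rpredM ?rpredB ?rpredN ?rpredX ?intr_int ?natr_int ?rpred1.
Qed.

Definition no_cancel s s' := s' != inv_letter s.

(** Each image lies in the arc of the letter just applied, hence outside the arc to be avoided by
    the next letter, since the two do not cancel. *)
Lemma word_mx_contracts s u z : path no_cancel s u ->
  cone (inv_letter (last s u)) z <= 0 ->
  0 <= cone s (mxact (word_mx (s :: u)) z).
Proof.
elim: u s => [|s' u IH] s /=.
  by move=> _ h; rewrite mulmx1 cone_letter oppr_ge0 pmulr_rle0.
move=> /andP[ss' /IH h] /h {}h.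
rewrite mxactM cone_letter oppr_ge0 pmulr_rle0 //.
exact: cone_disjoint h.
Qed.

(** Ping-pong for the inverse word, phrased without inverting the matrix. *)
Lemma word_mx_contracts_back s u z : path no_cancel s u ->
  cone s (mxact (word_mx (s :: u)) z) <= 0 ->
  0 <= cone (inv_letter (last s u)) z.
Proof.
elim: u s => [|s' u IH] s /=.
  by move=> _; rewrite mulmx1 cone_letter oppr_le0 pmulr_rge0.
move=> /andP[ss' /IH h].
rewrite mxactM cone_letter oppr_le0 pmulr_rge0 // => h'.
by apply: h; apply: cone_disjoint h'; rewrite eq_sym.
Qed.

Lemma cancelling_pair s u : ~~ path no_cancel s u ->
  exists u1 s' u2, s :: u = u1 ++ [:: s', inv_letter s' & u2].
Proof.
elim: u s => [//|s' u IH] s /=; rewrite negb_and => /orP[|/IH[u1 [s1 [u2 ->]]]].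
  by rewrite negbK => /eqP ->; exists [::], s, u.
by exists (s :: u1), s1, u2.
Qed.

Definition unit_point z := exists m n : int,
  [/\ z = (m%:~R, n%:~R), ~~ (p %| m)%Z & ~~ (p %| n)%Z].

(** Modulo [p] each letter is diagonal or antidiagonal with entries 1 or -1; the witnesses below
    separate the multiple of [p]. *)
Lemma unit_point_letter s z : unit_point z -> unit_point (mxact (letter_mx s) z).
Proof.
have p_neg (k : int) : (p %| - k)%Z = (p %| k)%Z by rewrite rpredN.
have p_add (k l : int) : (p %| p%:Z * k + l)%Z = (p %| l)%Z.
  by rewrite rpredDl // dvdz_mulr.
move=> [m [n [-> pm pn]]]; case: s => [] [] [].
- exists (p%:Z * (t * p%:Z * m - n) - m), (p%:Z * (- m) + n).
  rewrite !p_add p_neg; split=> //.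
  by rewrite /mxact !mxE /=; congr pair; ring.
- exists (p%:Z * n + m), (p%:Z * (m + t * p%:Z * n) - n).
  rewrite !p_add p_neg; split=> //.
  by rewrite /mxact !mxE /=; congr pair; ring.
- exists (p%:Z * m - n), (p%:Z * ((t - 1) * n) - m).
  rewrite !p_add !p_neg; split=> //.
  by rewrite /mxact !mxE /=; congr pair; ring.
- exists (p%:Z * ((t - 1) * m) + n), (p%:Z * n + m).
  rewrite !p_add; split=> //.
  by rewrite /mxact !mxE /=; congr pair; ring.
Qed.

(** On each vertex line one integral coordinate is a multiple of [p]. *)
Lemma unit_point_not_vertex z : unit_point z ->
  z.1 * z.2 * (P * z.1 - z.2) * (z.1 + P * z.2) != 0.
Proof.
move=> [m [n [-> pm pn]]] /=.
rewrite !mulf_eq0 !negb_or -(rmorph_nat intr) -!rmorphM -rmorphB -rmorphD /=.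
rewrite !intr_eq0 -!andbA; apply/and4P; split.
- by apply: contraNneq pm => ->; rewrite dvdz0.
- by apply: contraNneq pn => ->; rewrite dvdz0.
- rewrite subr_eq0; apply: contraNneq pn => <-.
  by rewrite natz dvdz_mulr.
- rewrite addr_eq0; apply: contraNneq pm => ->.
  by rewrite natz rpredN dvdz_mulr.
Qed.

(* Induction on the length: cancelling adjacent letters, or conjugating away a
   first letter inverse to the last one, shortens the word; when neither is
   possible, ping-pong puts the fixed point in two distinct arcs, hence at one of
   their endpoints, none of which is a unit point. *)
Lemma word_mx_not_parabolic u z : unit_point z -> ~ parabolic_at (word_mx u) z.
Proof.
have D0 : D != 0 by rewrite gt_eqF.
have [n] := ubnP (size u); elim: n u z => [//|n IH] u z.
case: u => [|s u] su zU Mz.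
  (* The empty word is scalar, whereas [parab l k z] has the off-diagonal entry [- k * z.1 ^+ 2]. *)
  have z1 : z.1 != 0.
    have := unit_point_not_vertex zU.
    by rewrite !mulf_eq0 !negb_or -!andbA => /andP[].
  case: Mz => l [k [l0 k0 h]]; have := h (1, 0); have := h (0, 1).
  rewrite !mxact_scalar /parab /cross /= => -[+ _] [_ +].
  have : k * z.1 ^+ 2 != 0 by rewrite mulf_neq0 // expf_neq0.
  by move=> /eqP; lra.
have [red|/cancelling_pair[u1 [s' [u2 e]]]] := boolP (path no_cancel s u); last first.
  apply: (IH (u1 ++ u2) z) => //.
    by move: su; rewrite -/(size (s :: u)) e !size_cat /=; lia.
  apply: (parabolicZ D0); move: Mz; rewrite e !word_mx_cat /= (mulmxA (letter_mx _)).
  by rewrite letter_mulV mul_scalar_mx scalemxAr.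
have [es|es] := eqVneq s (inv_letter (last s u)).
  case/lastP: u => [|u s'] in su Mz red es *.
    by have := inv_letter_neq s; rewrite {2}es eqxx.
  rewrite last_rcons in es.
  have es' : s' = inv_letter s by rewrite es inv_letterK.
  apply: (IH u (mxact (letter_mx s') z)).
  - by move: su; rewrite /= size_rcons; lia.
  - exact: unit_point_letter.
  case: Mz => l [k [l0 k0 h]].
  apply: (@parabolicZ _ (D ^+ 2)); first by rewrite expf_neq0.
  (* The letter [s'] is the adjugate of [s], so it passes across [cross] and leaves [k] unchanged;
     [D] comes from the product of the two letters. *)
  exists (l * D), k; split=> //; first by rewrite mulf_neq0.
  move=> w; set W := word_mx _ in h.
  have WE : D ^+ 2 *: word_mx u = letter_mx s' *m W *m letter_mx s.
    rewrite /W -cats1 -cat_cons word_mx_cat /= mulmx1 !mulmxA -mulmxA es'.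
    have := letter_mulV (inv_letter s); rewrite inv_letterK => ->.
    by rewrite mul_scalar_mx mul_mx_scalar scalerA.
  rewrite WE; move: W h {WE} => W h.
  rewrite !mxactM h es' /mxact /parab /cross /letter_det.
  by case: (s) => [] [] []; rewrite !mxE /=; congr pair; ring.
case: Mz => l [k [l0 k0 h]].
(* As [s] is not inverse to the last letter, the word maps the arc of [s] into itself. *)
have zs : 0 <= cone s z.
  have [e [f cE]] := cone_cross s; rewrite cE.
  apply: (parab_fixed_in_cone k0 (l := l)) => w; rewrite -!cE -h => ws.
  by apply: word_mx_contracts => //; apply: cone_disjoint ws.
have zs' : 0 <= cone (inv_letter (last s u)) z.
  have [e [f cE]] := cone_cross (inv_letter (last s u)); rewrite cE.
  (* [parab l (- k) z] inverts [parab l k z] up to the scalar [l ^+ 2]. *)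
  apply: (@parab_fixed_in_cone _ l (- k)); first by rewrite oppr_eq0.
  move=> w; rewrite -!cE => ws.
  apply: word_mx_contracts_back => //.
  apply: cone_disjoint (_ : inv_letter (last s u) != s) _; first by rewrite eq_sym.
  rewrite h cE (_ : _ * _ = (l ^+ 2) ^+ 2 * (cross w e * cross w f)); last first.
    by rewrite /parab /cross /=; ring.
  by rewrite -cE mulr_ge0 // exprn_even_ge0.
by have := unit_point_not_vertex zU; rewrite (cone_vertex es) ?eqxx.
Qed.

End Words.

(** * From elements of PSL_2 to matrices *)

Section PSL2Facts.
Variable R : realType.

Lemma val_repr_pi (A : SL2 R) : exists2 e : R, e ^+ 2 = 1 &
  val (repr (\pi_(PSL2 R) A)%qT) = e *: val A.
Proof.
have [->|->] := PSL2_repr_pi A; first by exists 1; rewrite ?expr1n ?scale1r.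
by exists (- 1); rewrite ?sqrrN ?expr1n // scaleN1r.
Qed.

Lemma val_insubd_SL2 (M : 'M[R]_2) : \det M = 1 ->
  val (insubd (SL2_one R) M) = M.
Proof. by move=> M1; rewrite val_insubd M1 eqxx. Qed.

Lemma to_PSL2M (M N : 'M[R]_2) : \det M = 1 -> \det N = 1 ->
  to_PSL2 (M *m N) = (to_PSL2 M * to_PSL2 N)%g.
Proof.
move=> M1 N1; rewrite /to_PSL2 [RHS](esym (PSL2_pi_mul _ _)); congr (\pi _)%qT.
by apply/val_inj; rewrite /= !val_insubd_SL2 // det_mulmx M1 N1 mulr1.
Qed.

Lemma to_PSL2_1 : to_PSL2 1%:M = 1%g :> PSL2 R.
Proof.
rewrite /to_PSL2; congr (\pi _)%qT; apply/val_inj.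
by rewrite val_insubd_SL2 ?det1.
Qed.

Lemma PSL2_act_to_PSL2 (M : 'M[R]_2) z : \det M = 1 ->
  PSL2_act (to_PSL2 M) z = mobius M z.
Proof. by move=> M1; rewrite PSL2_act_pi val_insubd_SL2. Qed.

Lemma unique_fixed_parabolic (M : 'M[R]_2) x : \det M = 1 ->
  (forall w, mobius M w = w <-> w = Some x) -> parabolic_at M (x, 1).
Proof.
rewrite (_ : M = mx22 (M 0 0) (M 0 1) (M 1 0) (M 1 1)); last first.
  by apply: matrix22P; rewrite mxE.
move: (M 0 0) (M 0 1) (M 1 0) (M 1 1) => a b c d.
rewrite det_mx22 => M1 fixM.
have c0 : c != 0.
  apply/eqP => c0; have := proj1 (fixM None).
  by rewrite /mobius !mxE /= c0 eqxx => /(_ erefl).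
have := proj2 (fixM (Some x)) erefl; rewrite /mobius !mxE /=.
case: eqVneq => // cxd0 [] /(canRL (mulfVK cxd0)) fx.
have bE : b = x * (c * x + d) - a * x by rewrite -fx; ring.
have ax : (a - c * x) * (c * x + d) = 1.
  by rewrite -M1 bE; ring.
have ax0 : a - c * x != 0.
  by apply: contra_eq_neq ax => ->; rewrite mul0r eq_sym oner_eq0.
(* By Vieta this is the other root of the quadratic fixed-point equation, so uniqueness makes [x] a
   double root. *)
have := proj1 (fixM (Some ((a - d) / c - x))).
rewrite /mobius !mxE /= (_ : c * _ + d = a - c * x); last by field.
have yE : (a * ((a - d) / c - x) + b) / (a - c * x) = (a - d) / c - x.
  by apply: (mulIf ax0); rewrite mulfVK // bE; field.
rewrite (negPf ax0) yE => /(_ erefl)[] /(canRL (subrK _)) /(canRL (mulfVK c0)) ad.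
have aE : a = (x + x) * c + d by rewrite -ad subrK.
exists (c * x + d), c; split=> // w; rewrite /mxact /parab /cross !mxE /=.
congr pair; last by ring.
by rewrite bE aE; ring.
Qed.

End PSL2Facts.

Lemma injective_seq_infinite (X : Type) (A : set X) (f : nat -> X) :
  injective f -> (forall i, A (f i)) -> infinite_set A.
Proof.
move=> f_inj fA finA; apply: infinite_nat.
have -> : [set: nat] = f @^-1` A by apply/seteqP; split=> i // _; exact: fA.
by apply: finite_preimage finA => i j _ _; exact: f_inj.
Qed.

(** * The point 1/p and the groups Delta(1/p^2, 2t) *)

Section DeltaInvPrimeSquare.
Variables (R : realType) (p : nat) (t : int).
Hypotheses (p_prime : prime p) (t_ge2 : 2 <= t).
Local Notation P := (p%:R : R).
Local Notation T := (t%:~R : R).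
Local Notation G := (Delta R (p%:R ^- 2) t%:~R).
Local Notation D := (letter_det R p t).
Local Notation dil := (mx22 P 0 0 1).

Let P0 : P != 0.
Proof. by rewrite pnatr_eq0 -lt0n prime_gt0. Qed.

Lemma invsq_gt0 : 0 < p%:R ^- 2 :> rat.
Proof. by rewrite invr_gt0 exprn_gt0 // ltr0n prime_gt0. Qed.

Lemma invsq_lt : p%:R ^- 2 < t%:~R - 1 :> rat.
Proof.
apply: (@lt_le_trans _ _ 1).
  rewrite invf_lt1; first by rewrite exprn_egt1 // ltr1n prime_gt1.
  by rewrite exprn_gt0 // ltr0n prime_gt0.
by rewrite lerBrDr (ler_int _ 2).
Qed.

Let ratr_invsq : ratr (p%:R ^- 2) = P ^- 2.
Proof. by rewrite fmorphV rmorphXn /= ratr_nat. Qed.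

(* [dil] conjugates [Delta] to the group generated by the integral matrices
   [letter_mx]. *)
Definition is_word (g : PSL2 R) := exists u (k : R),
  k != 0 /\ dil *m val (repr g) = k *: (word_mx R p t u *m dil).

Lemma is_word_pi (A : SL2 R) u (k : R) : k != 0 ->
  dil *m val A = k *: (word_mx R p t u *m dil) -> is_word (\pi_(PSL2 R) A)%qT.
Proof.
move=> k0 h; have [e e1 eE] := val_repr_pi A.
have e0 : e != 0 by apply: contra_eq_neq e1 => ->; rewrite expr0n eq_sym oner_eq0.
by exists u, (e * k); rewrite mulf_neq0 // eE -scalemxAr h scalerA.
Qed.

Lemma is_word_subgroup : is_subgroup is_word.
Proof.
split=> [|g h [u [k [k0 gE]]] [u' [k' [k'0 hE]]]|g [u [k [k0 gE]]]].
- by apply: (@is_word_pi _ [::] 1); rewrite ?oner_eq0 //= mulmx1 mul1mx scale1r.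
- apply: (@is_word_pi _ (u ++ u') (k * k')); first by rewrite mulf_neq0.
  rewrite /= mulmxA gE -scalemxAl -mulmxA hE -scalemxAr scalerA.
  by rewrite mulmxA word_mx_cat.
- have [u' u'E] := word_mx_inv R p t u.
  set d := D ^+ size u in u'E.
  have d0 : d != 0 by rewrite expf_neq0 // gt_eqF // letter_det_gt0.
  apply: (@is_word_pi _ u' (k * d)^-1); first by rewrite invr_eq0 mulf_neq0.
  have : word_mx R p t u' *m (dil *m val (repr g)) = (k * d) *: dil.
    by rewrite gE -scalemxAr mulmxA u'E mul_scalar_mx scalerA.
  move/(congr1 (mulmx^~ (\adj (val (repr g))))).
  rewrite -!mulmxA mul_mx_adj SL2_det mulmx1 -scalemxAl => ->.
  by rewrite scalerA mulVf ?scale1r // mulf_neq0.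
Qed.

Lemma Delta_is_word : G `<=` is_word.
Proof.
have c0 : 0 < - 1 + ratr t%:~R - ratr (p%:R ^- 2) :> R := Delta_pos R invsq_lt.
apply: smallest_sub; first exact: is_word_subgroup.
move=> _ [] ->.
  apply: (@is_word_pi _ [:: (false, false)]
    ((Num.sqrt (- 1 + ratr t%:~R - ratr (p%:R ^- 2)))^-1 / P)).
    by rewrite mulf_neq0 ?invr_eq0 // gt_eqF // sqrtr_gt0.
  rewrite val_insubd_SL2 ?det_Delta_g1 ?invsq_lt // /Delta_g1 -scalemxAr.
  rewrite -scalerA; congr (_ *: _).
  apply: matrix22P; rewrite /= mulmx1 [RHS]mxE !mulmx22E !mxE /= ?ratr_invsq ?ratr_int;
  by field.
apply: (@is_word_pi _ [:: (true, false)]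
    ((Num.sqrt (ratr (p%:R ^- 2)) *
      Num.sqrt (- 1 + ratr t%:~R - ratr (p%:R ^- 2)))^-1 * P ^- 2)).
  rewrite mulf_neq0 ?invr_eq0 ?expf_neq0 // mulf_neq0 // gt_eqF // sqrtr_gt0 //.
  by rewrite ltr0q invsq_gt0.
rewrite val_insubd_SL2 ?det_Delta_g2 ?invsq_lt ?invsq_gt0 // /Delta_g2 -scalemxAr.
rewrite -scalerA; congr (_ *: _).
apply: matrix22P; rewrite /= mulmx1 [RHS]mxE !mulmx22E !mxE /= ?ratr_invsq ?ratr_int;
by field.
Qed.

Lemma inv_prime_not_cusp : ~ cusp_set G (Some P^-1).
Proof.
move=> [g /Delta_is_word[u [k [k0 gE]]] /unique_fixed_parabolic].
move=> /(_ (SL2_det _)) [l [c [l0 c0 gp]]].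
apply: (@word_mx_not_parabolic R p t p_prime t_ge2 u (1, 1)).
  have p1 : ~~ (p %| 1)%Z by rewrite dvdz1 absz_nat gtn_eqF // prime_gt1.
  by exists 1, 1; rewrite !mulr1z.
apply: (@parabolicZ _ k) => //; exists l, (c / P).
split=> //; first by rewrite mulf_neq0 ?invr_eq0.
move=> w.
have -> : k *: word_mx R p t u = dil *m val (repr g) *m mx22 P^-1 0 0 1.
  rewrite gE -scalemxAl -mulmxA (_ : dil *m _ = 1%:M) ?mulmx1 //.
  by apply: matrix22P; rewrite mulmx22E !mxE /=; field.
rewrite !mxactM gp /mxact /parab /cross !mxE /=.
by congr pair; field.
Qed.

(** The identity plus [k] times the nilpotent product of the column (1, P) and the row (P, -1),
    hence additive in [k]. *)
Definition cusp_shear (k : int) : 'M[R]_2 :=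
  mx22 (1 + k%:~R * P) (- k%:~R) (k%:~R * P ^+ 2) (1 - k%:~R * P).

Lemma det_cusp_shear k : \det (cusp_shear k) = 1.
Proof. by rewrite det_mx22; ring. Qed.

Lemma cusp_shearD k l : cusp_shear (k + l) = cusp_shear k *m cusp_shear l.
Proof.
by apply: matrix22P; rewrite mulmx22E !mxE /= intrD; ring.
Qed.

Lemma cusp_shear_fixed k w : k != 0 ->
  PSL2_act (to_PSL2 (cusp_shear k)) w = w <-> w = Some P^-1.
Proof.
move=> k0; rewrite PSL2_act_to_PSL2 ?det_cusp_shear //.
have k0' : k%:~R != 0 :> R by rewrite intr_eq0.
case: w => [x|]; rewrite /mobius !mxE /=; last first.
  by rewrite (negPf (mulf_neq0 _ _)) // expf_neq0.
split.
  case: eqVneq => // d0 [] /(canRL (mulfVK d0)) fx; congr Some.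
  have : k%:~R * (P * x - 1) ^+ 2 = 0.
    rewrite -[RHS](subrr (x * (k%:~R * P ^+ 2 * x + (1 - k%:~R * P)))).
    by rewrite -{2}fx; ring.
  move/eqP; rewrite mulf_eq0 (negPf k0') expf_eq0 /= subr_eq0 => /eqP Px.
  by apply: (mulfI P0); rewrite Px divff.
move=> [->].
rewrite (_ : _ * _^-1 + _ = 1); last by field.
by rewrite oner_eq0 divr1; congr Some; field.
Qed.

Lemma inv_prime_cusp_of_arithmetic : arithmetic G -> cusp_set G (Some P^-1).
Proof.
move=> [_ finZ].
pose c k := to_PSL2 (cusp_shear k).
have cD k l : c (k + l) = (c k * c l)%g.
  by rewrite /c cusp_shearD to_PSL2M ?det_cusp_shear.
have cZ k : PSL2Z (c k).
  exists (insubd (SL2_one R) (cusp_shear k)) => //=.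
  rewrite val_insubd_SL2 ?det_cusp_shear //; apply: mx22_over_int;
  by rewrite ?rpredD ?rpredB ?rpredN ?rpredM ?rpredX ?intr_int ?natr_int ?rpred1.
pose H := G `&` @PSL2Z R.
(* Pigeonhole: two cosets of shears coincide, so a nontrivial shear lies in [G]. *)
have [i [j [ij eqH]]] : exists i j : nat, i <> j /\
    [set (c i * h)%g | h in H] = [set (c j * h)%g | h in H].
  apply: contrapT => noij; move: finZ.
  apply: (@injective_seq_infinite _ _ (fun i : nat => [set (c i * h)%g | h in H])).
    by move=> i j eqH; apply: contrapT => ij; apply: noij; exists i, j.
  by move=> i; exists (c i).
have c0 : c 0 = 1%g by apply: (mulgI (c 0)); rewrite -cD addr0 mulg1.
have H1 : H 1%g by split; [move=> S [[]] | rewrite -c0].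
have [h [Gh _] cj] : [set (c i * h)%g | h in H] (c j).
  by rewrite eqH; exists 1%g; rewrite ?mulg1.
exists h => // w.
have -> : h = c (j%:Z - i%:Z).
  by apply: (mulgI (c i)); rewrite cj -cD; congr c; ring.
by apply: cusp_shear_fixed; rewrite subr_eq0; apply/eqP => -[] /esym.
Qed.

Lemma inv_prime_rational : P1Q (Some P^-1 : P1 R).
Proof. by right; exists p%:R^-1; rewrite fmorphV /= ratr_nat. Qed.

Lemma Delta_not_arithmetic : ~ arithmetic G.
Proof. by move=> /inv_prime_cusp_of_arithmetic/inv_prime_not_cusp. Qed.

Lemma Delta_not_pseudomodular : ~ pseudomodular G.
Proof.
by move=> [_ GE]; apply: inv_prime_not_cusp; rewrite GE; exact: inv_prime_rational.
Qed.

End DeltaInvPrimeSquare.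

(** * Infinitely many distinct groups *)

Lemma Delta_g1_in (R : realType) u2 t : Delta R u2 t (to_PSL2 (Delta_g1 R u2 t)).
Proof. by apply: sub_gen_smallest; left. Qed.

(* In coordinates rescaled by [dil], the lower left entry of the first generator of the
   second group is [1 / sqrt det'], while the elements of the first group are
   integral matrices divided by half-integral powers of [det]. *)
Lemma Delta_eq_letter_det (R : realType) (p : nat) (t t' : int) :
  prime p -> 2 <= t -> 2 <= t' ->
  Delta R (p%:R ^- 2) t%:~R = Delta R (p%:R ^- 2) t'%:~R ->
  exists (m : int) n, letter_det R p t' * m%:~R ^+ 2 = letter_det R p t ^+ n.
Proof.
move=> p_prime t2 t'2 eqG.
have P0 : p%:R != 0 :> R by rewrite pnatr_eq0 -lt0n prime_gt0.
have D'0 := letter_det_gt0 R p_prime t'2.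
have := @Delta_g1_in R (p%:R ^- 2) t'%:~R; rewrite -eqG.
move=> /(Delta_is_word p_prime t2)[u [k [k0 gE]]].
have [m Wm] : exists m : int, word_mx R p t u 1 0 = m%:~R.
  by apply/intrP; move/mxOverP: (word_mx_int R p t u); exact.
exists m, (size u); move: (gE).
(* Determinants give [k ^+ 2 * D ^+ n = 1], with [n] the length of [u]; the lower left entries then
   give [D' * (k * m) ^+ 2 = 1]. *)
move=> /(congr1 determinant).
rewrite detZ !det_mulmx SL2_det det_word_mx det_mx22 !mulr1 mulr0 subr0 mulrA.
move=> /(canLR (mulfK P0)); rewrite divff // => /esym kD.
move: gE; have [e e1 ->] :=
  val_repr_pi (insubd (SL2_one R) (Delta_g1 R (p%:R ^- 2) t'%:~R)).
rewrite val_insubd_SL2; last first.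
  exact/det_Delta_g1/invsq_lt.
move=> /matrixP/(_ 1 0); rewrite /Delta_g1.
set r := - 1 + _ - _.
have rE : r = letter_det R p t' / p%:R ^+ 2.
  by rewrite /r /letter_det ratr_int fmorphV rmorphXn /= ratr_nat; field.
have r0 : 0 < r by rewrite rE divr_gt0 // exprn_even_gt0.
rewrite [RHS]mxE !mulmx22E Wm !mxE /= => /(congr1 (fun x => x ^+ 2)).
rewrite (_ : (_ + _) ^+ 2 = e ^+ 2 * (Num.sqrt r ^+ 2)^-1); last first.
  by field; rewrite sqrtr_eq0 -ltNge.
rewrite e1 mul1r sqr_sqrtr ?ltW // rE => h.
set D' := letter_det R p t' in h D'0 *; set D := letter_det R p t in kD *.
have {}h : D' * (k ^+ 2 * m%:~R ^+ 2) = 1.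
  have D'n0 : D' != 0 by rewrite gt_eqF.
  have : D' / p%:R ^+ 2 * (D' / p%:R ^+ 2)^-1 = 1.
    by rewrite divff // mulf_neq0 // invr_eq0 expf_neq0.
  by rewrite h => rr; rewrite -[RHS]rr; field.
by rewrite -[RHS]mul1r -[in RHS]h -[LHS]mul1r -[X in X * _ = _]kD; ring.
Qed.

(* [4 * coprime_seq n - 1] is [letter_det] for [p = 2], [t = coprime_seq n + 1]. *)
Fixpoint coprime_seq n : nat :=
  if n is n'.+1 then coprime_seq n' * (4 * coprime_seq n' - 1) else 1.

Lemma coprime_seq_gt0 n : (0 < coprime_seq n)%N.
Proof. by elim: n => //= n IH; rewrite muln_gt0 IH; lia. Qed.

Lemma coprime_seq_dvd i j : (i < j)%N ->
  (4 * coprime_seq i - 1 %| coprime_seq j)%N.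
Proof.
elim: j => // j IH; rewrite ltnS leq_eqVlt => /orP[/eqP->|/IH ij] /=.
  exact: dvdn_mull.
exact: dvdn_mulr.
Qed.

(** The first number divides [4 * coprime_seq j], the successor of the second. *)
Lemma coprime_seq_coprime i j : (i < j)%N ->
  coprime (4 * coprime_seq i - 1) (4 * coprime_seq j - 1).
Proof.
move=> ij; apply: (@coprime_dvdl _ (4 * coprime_seq j - 1).+1).
  have -> : (4 * coprime_seq j - 1).+1 = (4 * coprime_seq j)%N.
    by have := coprime_seq_gt0 j; lia.
  by rewrite dvdn_mull ?coprime_seq_dvd.
exact: coprimeSn.
Qed.

Lemma letter_det_coprime_seq (R : realType) n :
  letter_det R 2 ((coprime_seq n)%:Z + 1) = (4 * coprime_seq n - 1)%:R.
Proof.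
rewrite /letter_det natrB ?muln_gt0 ?coprime_seq_gt0 // natrM intrD.
by rewrite -[(coprime_seq n)%:~R]/((coprime_seq n)%:R); ring.
Qed.

Lemma coprime_seq_Delta_inj (R : realType) :
  injective (fun n => Delta R (2%:R ^- 2) ((coprime_seq n)%:Z + 1)%:~R).
Proof.
have t2 n : 2 <= (coprime_seq n)%:Z + 1 by have := coprime_seq_gt0 n; lia.
suff inj i j : (i < j)%N -> Delta R (2%:R ^- 2) ((coprime_seq i)%:Z + 1)%:~R <>
    Delta R (2%:R ^- 2) ((coprime_seq j)%:Z + 1)%:~R.
  move=> i j eqG; case: (ltngtP i j) => // ij; first by case: (inj i j ij).
  by case: (inj j i ij).
move=> ij /(Delta_eq_letter_det (isT : prime 2) (t2 i) (t2 j))[m [n]].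
rewrite !letter_det_coprime_seq => h.
have {}h : ((4 * coprime_seq j - 1) * `|m| ^ 2 = (4 * coprime_seq i - 1) ^ n)%N.
  apply/eqP; rewrite -(eqr_nat R) natrM !natrX -h; apply/eqP; congr (_ * _).
  by rewrite natr_absz intr_norm real_normK ?num_real.
(* By [h] the determinant for [j] divides a power of the one for [i]; coprimality would make it 1,
   but it is at least 3. *)
have := coprime_seq_coprime ij => /(coprimeXl n).
rewrite -h coprimeMl /coprime gcdnn => /andP[].
by have := coprime_seq_gt0 j; lia.
Qed.

Theorem theorem2 (R : realType) :
  (forall (p : nat) (t : int), prime p -> 2 <= t ->
     ~ pseudomodular (Delta R (p%:R ^- 2) t%:~R) /\
     ~ arithmetic (Delta R (p%:R ^- 2) t%:~R)) /\
  infinite_set [set G : set (PSL2 R) |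
    exists u2 t : rat, [/\ 0 < u2, u2 < t - 1, G = Delta R u2 t,
      ~ pseudomodular G & ~ arithmetic G]].
Proof.
split=> [p t p_prime t2|].
  by split; [exact: Delta_not_pseudomodular | exact: Delta_not_arithmetic].
apply: injective_seq_infinite (@coprime_seq_Delta_inj R) _ => n.
have t2 : 2 <= (coprime_seq n)%:Z + 1 by have := coprime_seq_gt0 n; lia.
have p2 : prime 2 by [].
exists (2%:R ^- 2), ((coprime_seq n)%:Z + 1)%:~R; split=> //.
- exact: invsq_lt.
- exact: Delta_not_pseudomodular.
- exact: Delta_not_arithmetic.
Qed.
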